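(* Let $V:\mathbb{R}^2\to[0,\infty)$ be Hölder continuous with compact support and $\int V=1$, and let $\tau>0$. For $\varepsilon\in(0,1)$ set $V^\varepsilon(x)=\varepsilon^{-2}V(x/\varepsilon)$ and $V_\varepsilon(x)=\varepsilon^{-2}|\log\varepsilon|^{-1}V(x/\varepsilon)$. For all sufficiently small $\varepsilon$ let $u^\varepsilon\in C^2(\mathbb{R}^2)$ be the unique function with $u^\varepsilon(x)=O(|\log|x||)$ as $|x|\to\infty$ satisfying $$u^\varepsilon(x)=\frac{\tau}{2\pi}\int_{\mathbb{R}^2}\log|x-y|\big[V_\varepsilon(y)u^\varepsilon(y)+V^\varepsilon(y)\big]dy.$$ Then for every $k>0$, $$\lim_{\varepsilon\to0}\sup_{|x|\le k}\left|u^\varepsilon(\varepsilon x)|\log\varepsilon|^{-1}+\frac{\tau}{2\pi+\tau}\right|=0.$$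
   Context: Existence and uniqueness of $u^\varepsilon$ for small $\varepsilon$ (in the class of $C^2$ functions with logarithmic growth) is part of the setting and is taken as given. *)

(* Defs.v *)
From HB Require Import structures.
From mathcomp Require Import all_boot all_order all_algebra.
From mathcomp Require Import all_classical all_reals all_analysis.
Set Implicit Arguments. Unset Strict Implicit. Unset Printing Implicit Defensive.
Import Order.TTheory GRing.Theory Num.Theory.
Import numFieldNormedType.Exports.
Local Open Scope classical_set_scope.
Local Open Scope ring_scope.

Section Plane.
Variable R : realType.

(* Euclidean norm on R^2 (the library norm on R * R is the max norm). *)
Definition enorm (x : R * R) : R := Num.sqrt (x.1 ^+ 2 + x.2 ^+ 2).

Definition leb2 := ((@lebesgue_measure R) \x (@lebesgue_measure R))%E.

Definition e1 : R * R := (1, 0).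
Definition e2 : R * R := (0, 1).

Definition pd (v : R * R) (f : R * R -> R) : R * R -> R := fun x => 'D_v f x.

Definition C2 (f : R * R -> R) : Prop :=
  continuous f /\
  (forall v, v \in [:: e1; e2] ->
     (forall x, derivable f x v) /\ continuous (pd v f) /\
     (forall w, w \in [:: e1; e2] ->
        (forall x, derivable (pd v f) x w) /\ continuous (pd w (pd v f)))).

Definition holder_continuous (V : R * R -> R) : Prop :=
  exists alpha : R, exists C : R, 0 < alpha /\ alpha <= 1 /\
    forall x y, `|V x - V y| <= C * (enorm (x - y)) `^ alpha.

Definition compact_support (V : R * R -> R) : Prop :=
  compact (closure [set x | V x != 0]).

Definition sdiv (x : R * R) (eps : R) : R * R := (x.1 / eps, x.2 / eps).
Definition smul (eps : R) (x : R * R) : R * R := (eps * x.1, eps * x.2).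

Definition Vsup (V : R * R -> R) (eps : R) (x : R * R) : R :=
  eps ^- 2 * V (sdiv x eps).
Definition Vsub (V : R * R -> R) (eps : R) (x : R * R) : R :=
  eps ^- 2 * `|ln eps|^-1 * V (sdiv x eps).

Definition log_growth (u : R * R -> R) : Prop :=
  exists C : R, exists r0 : R, forall x, r0 <= enorm x ->
    `|u x| <= C * `|ln (enorm x)|.

Definition kern (tau : R) (V : R * R -> R) (eps : R) (u : R * R -> R)
  (x : R * R) : R * R -> R :=
  fun y => ln (enorm (x - y)) * (Vsub V eps y * u y + Vsup V eps y).

Definition solves_eq (tau : R) (V : R * R -> R) (eps : R) (u : R * R -> R) : Prop :=
  forall x, leb2.-integrable setT (fun y => (kern tau V eps u x y)%:E) /\
    u x = tau / (2 * pi) * Rintegral leb2 setT (kern tau V eps u x).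

End Plane.

(* Main.v *)
Require Import Defs.
From HB Require Import structures.
From mathcomp Require Import all_boot all_order all_algebra.
From mathcomp Require Import all_classical all_reals all_analysis.
From mathcomp Require Import measurable_realfun ring lra.
Import Order.TTheory GRing.Theory Num.Theory.
Import numFieldNormedType.Exports.
Local Open Scope classical_set_scope.
Local Open Scope ring_scope.

(* With L = |ln eps|, a = tau / (2 pi) and h = u / L + 1, the bracket
   V_eps u + V^eps is W h for W = V^eps, so that the equation reads
     h x = 1 + (a / L) \int ln |x - y| W(y) h(y) dy.
   W is a probability density supported in |y| <= eps r, and for |x| <= eps r
     \int |ln |x - y| + L| W(y) dy <= C
   uniformly in eps, hence h x = 1 - a m + O(sup |h| / L) with m = \int W h.
   Integrating against W gives m = 1 / (1 + a) + O(sup |h| / L), so sup |h|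
   stays bounded and h = 1 / (1 + a) + O(1 / L) on |x| <= eps r. *)

(** * Stability of an integral fixed-point equation with an almost constant kernel *)

Lemma normr_Rintegral_le d (T : measurableType d) (R : realType)
    (mu : {measure set T -> \bar R}) (f : T -> R) (c : R) :
  mu.-integrable setT (EFin \o f) ->
  (\int[mu]_x `|f x|%:E <= c%:E)%E ->
  `|Rintegral mu setT f| <= c.
Proof.
move=> intf le_fc; rewrite -lee_fin EFin_normr_Rintegral//.
apply: le_trans le_fc; apply: (le_trans (le_abse_integral mu measurableT _)) => //.
exact: measurable_int intf.
Qed.

Section fixed_point_stability.
Context d (T : measurableType d) (R : realType) (mu : {measure set T -> \bar R}).
Variables (A : set T) (W h : T -> R) (G : T -> T -> R) (a C L : R).
Hypotheses (a0 : 0 < a) (C0 : 0 <= C) (L0 : 0 < L).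
Hypotheses (W0 : forall y, 0 <= W y) (mW : measurable_fun setT W).
Hypothesis supp_W : forall y, ~ A y -> W y = 0.
Hypothesis int_W : (\int[mu]_x (W x)%:E = 1)%E.
Hypothesis mh : measurable_fun setT h.
Hypothesis mG : forall x, measurable_fun setT (G x).
Hypothesis int_GWh :
  forall x, A x -> mu.-integrable setT (EFin \o (fun y => G x y * (W y * h y))).
(** The kernel is the constant [- L] up to an error whose mean against [W] is at most [C]. In the
    application [G x y] is ln |x - y| and [L] is |ln eps|. *)
Hypothesis kernel_le :
  forall x, A x -> (\int[mu]_y (`|G x y + L| * W y)%:E <= C%:E)%E.
Hypothesis h_fix : forall x, A x ->
  h x = 1 + a / L * Rintegral mu setT (fun y => G x y * (W y * h y)).

Let integrable_W : mu.-integrable setT (EFin \o W).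
Proof.
apply/integrableP; split; first exact/measurable_EFinP.
under eq_integral do rewrite /= ger0_norm//.
by rewrite int_W ltry.
Qed.

Let int_mulr_le (f g : T -> R) (c : R) : 0 <= c ->
  measurable_fun setT f -> measurable_fun setT g -> (forall y, 0 <= g y) ->
  (forall y, `|f y| <= c * g y) ->
  (\int[mu]_y `|f y|%:E <= c%:E * \int[mu]_y (g y)%:E)%E.
Proof.
move=> c0 mf mg g0 fg; rewrite -ge0_integralZl//; last 2 first.
- exact/measurable_EFinP.
- by move=> x _; rewrite lee_fin.
apply: ge0_le_integral => //.
- by apply/measurable_EFinP; apply: measurableT_comp.
- by apply/measurable_EFinP; exact: measurable_funM.
- by move=> y _; rewrite -EFinM lee_fin.
Qed.

(** Were [G] equal to [- L], [h] would be the constant 1 - a m on [A], with m the mean of [h]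
    against [W]; averaging would give m = 1 / (1 + a), which is then also the value of [h]. Each of
    the two approximations costs a C M / L, whence the factor 2. *)
Let stability_bound (M : R) : 0 <= M -> (forall y, A y -> `|h y| <= M) ->
  forall x, A x -> `|h x - (1 + a)^-1| <= 2 * (a * C / L) * M.
Proof.
move=> M0 hM.
(* Since [W] vanishes off [A], bounds known only on [A] hold everywhere after multiplication by
   [W]. *)
have bW y (c f : R) : (A y -> `|f| <= c) -> `|W y * f| <= c * W y.
  move=> fc; have [/fc fc'|/supp_W ->] := pselect (A y); last first.
    by rewrite mul0r mulr0 normr0.
  by rewrite normrM ger0_norm// mulrC ler_wpM2r.
have integrable_Wh : mu.-integrable setT (EFin \o (fun y => W y * h y)).
  apply: (@le_integrable _ _ _ mu setT measurableT _ (EFin \o (fun y => M * W y))).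
  - by apply/measurable_EFinP; exact: measurable_funM.
  - move=> y _ /=; rewrite lee_fin (le_trans (bW y M _ (hM y)))//.
    exact: ler_norm.
  - exact: integrableZl integrable_W.
pose m := Rintegral mu setT (fun y => W y * h y).
have near x : A x -> `|h x - (1 - a * m)| <= a * C / L * M.
  move=> Ax.
  have iLWh : mu.-integrable setT (EFin \o (fun y => L * (W y * h y))).
    exact: integrableZl integrable_Wh.
  (* The term a m equals a / L times the integral of L W h, so the difference involves only
     [G x y + L], which is controlled by [kernel_le]. *)
  have -> : h x - (1 - a * m) =
      a / L * Rintegral mu setT (fun y => G x y * (W y * h y) + L * (W y * h y)).
    rewrite RintegralD//; last exact: int_GWh.
    by rewrite RintegralZl// -/m [h x]h_fix//; field; rewrite gt_eqF.
  have aL0 : 0 <= a / L by rewrite divr_ge0 ?ltW.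
  rewrite normrM (ger0_norm aL0).
  have -> : a * C / L * M = a / L * (M * C) by ring.
  rewrite ler_wpM2l//.
  apply: normr_Rintegral_le.
    have iD := integrableD measurableT (int_GWh x Ax) iLWh.
    by apply: (eq_integrable measurableT _ _ _ iD).
  apply: (le_trans (@int_mulr_le _ (fun y => `|G x y + L| * W y) _ M0 _ _ _ _)).
  - apply: measurable_funD; first by do 2 apply: measurable_funM => //.
    by do 2 apply: measurable_funM => //.
  - apply: measurable_funM => //; apply: measurableT_comp => //.
    exact: measurable_funD.
  - by move=> y; rewrite mulr_ge0.
  - move=> y; rewrite -mulrDl normrM [leRHS]mulrCA ler_wpM2l//.
    exact: bW (hM y).
  - by rewrite EFinM lee_wpmul2l ?lee_fin//; exact: kernel_le.
set D := a * C / L * M in near *.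
have D0 : 0 <= D by rewrite mulr_ge0// divr_ge0 ?mulr_ge0// ltW.
have near_m : `|m - (1 - a * m)| <= D.
  set c := 1 - a * m in near *.
  have int_W1 : Rintegral mu setT W = 1 by rewrite /Rintegral int_W.
  have icW : mu.-integrable setT (EFin \o (fun y => c * W y)).
    exact: integrableZl integrable_W.
  have -> : m - c = Rintegral mu setT (fun y => W y * h y - c * W y).
    by rewrite RintegralB// RintegralZl// int_W1 mulr1.
  apply: normr_Rintegral_le.
    have iB := integrableB measurableT integrable_Wh icW.
    by apply: (eq_integrable measurableT _ _ _ iB).
  apply: (le_trans (@int_mulr_le _ W _ D0 _ _ _ _)) => //.
  - by apply: measurable_funB; exact: measurable_funM.
  - by move=> y; rewrite mulrC -mulrBl mulrC; exact: bW (near y).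
  - by rewrite int_W mule1.
move=> x /near; set e := m - _ in near_m.
(* Here e = (1 + a) m - 1, and its coefficient a / (1 + a) is at most 1. *)
have -> : h x - (1 + a)^-1 = h x - (1 - a * m) - a / (1 + a) * e.
  by rewrite /e; field; rewrite gt_eqF// addr_gt0.
move=> near_x; rewrite (le_trans (ler_normB _ _))//.
have -> : 2 * (a * C / L) * M = D + D by rewrite /D; ring.
have a1 : 0 < 1 + a by rewrite addr_gt0.
rewrite lerD// normrM (le_trans _ near_m)// ler_piMl//.
by rewrite ger0_norm ?ler_pdivrMr ?mul1r ?lerDr// divr_ge0 ?ltW.
Qed.

(** A bootstrap: [M0] only makes the supremum of |h| over [A] finite. Applying [stability_bound]
    with that supremum as [M] and absorbing it gives sup |h| <= 2; a second application with [M] = 2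
    gives the rate, which is free of [M0]. *)
Lemma fixed_point_stability (M0 : R) : 4 * (a * C) <= L ->
  (forall y, A y -> `|h y| <= M0) ->
  forall x, A x -> `|h x - (1 + a)^-1| <= 4 * (a * C) / L.
Proof.
move=> aCL hM0 x Ax.
pose S := [set `|h y| | y in A].
have S_sup : has_sup S.
  split; first by exists `|h x|; exists x.
  by exists M0 => _ [y Ay <-]; exact: hM0.
have S_le y : A y -> `|h y| <= sup S.
  by move=> Ay; apply: sup_upper_bound => //; exists y.
have S0 : 0 <= sup S by exact: le_trans (S_le _ Ax).
have S2 : sup S <= 2.
  (* The 1 bounds 1 / (1 + a), and the half comes from 2 a C / L <= 1 / 2. *)
  suff : sup S <= 1 + sup S / 2 by lra.
  apply: ge_sup; first by case: S_sup.
  move=> _ [y Ay <-].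
  have := stability_bound _ S0 S_le y Ay.
  have : 2 * (a * C / L) * sup S <= 2^-1 * sup S.
    rewrite ler_wpM2r//.
    have -> : 2 * (a * C / L) = 2 * (a * C) / L by ring.
    by rewrite ler_pdivrMr//; lra.
  have a1 : 0 < 1 + a by rewrite addr_gt0.
  have : (1 + a)^-1 <= 1 by rewrite invf_le1// lerDl ltW.
  have : 0 < (1 + a)^-1 by rewrite invr_gt0.
  have -> : `|h y| = `|h y - (1 + a)^-1 + (1 + a)^-1| by rewrite subrK.
  move=> i0 i1 sb hb; rewrite (le_trans (ler_normD _ _))//.
  by rewrite (ger0_norm (ltW i0)); lra.
have -> : 4 * (a * C) / L = 2 * (a * C / L) * 2 by ring.
by apply: stability_bound => // y Ay; exact: le_trans (S_le _ Ay) S2.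
Qed.

End fixed_point_stability.

(** * Borel sets of the plane and the behaviour of Lebesgue measure under dilation *)

Section plane_measurability.
Context {R : realType}.

(** Balls of the max norm are squares, so an open set is the union of the rational open rectangles
    that it contains, a countable family. Rectangles not contained in [A] are replaced by the empty
    set. *)
Lemma open_measurable_plane (A : set (R * R)) : open A -> measurable A.
Proof.
move=> oA.
pose box (q : rat * rat * (rat * rat)) : set (R * R) :=
  `]ratr q.1.1, ratr q.1.2[%classic `*` `]ratr q.2.1, ratr q.2.2[%classic.
have -> : A = \bigcup_(q in [set: rat * rat * (rat * rat)])
    (if pselect (box q `<=` A) then box q else set0).
  apply/seteqP; split=> [[x y] Axy|z [q _]]; last first.
    by case: pselect => [|_ []]; exact.
  have /nbhs_ballP[e /= e0 eA] : nbhs (x, y) A by exact: open_nbhs_nbhs.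
  have [xe ex] : x - e < x /\ x < x + e by split; lra.
  have [ye ey] : y - e < y /\ y < y + e by split; lra.
  have [q1] := rat_in_itvoo xe; rewrite in_itv/= => /andP[q1l q1r].
  have [q2] := rat_in_itvoo ex; rewrite in_itv/= => /andP[q2l q2r].
  have [q3] := rat_in_itvoo ye; rewrite in_itv/= => /andP[q3l q3r].
  have [q4] := rat_in_itvoo ey; rewrite in_itv/= => /andP[q4l q4r].
  exists ((q1, q2), (q3, q4)) => //; case: pselect => [?|[]].
    by split; rewrite /= in_itv/=; apply/andP.
  move=> [s t]; rewrite /box/= !in_itv/= => -[/andP[s1 s2] /andP[t1 t2]].
  apply: eA; split; rewrite /= -ball_normE/= ltr_norml; apply/andP; split; lra.
apply: countable_bigcupT_measurable; first exact: countableP.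
move=> q; case: pselect => [?|?] /=; last exact: measurable0.
apply: measurableX; exact: measurable_itv.
Qed.

Lemma continuous_measurable_plane (f : R * R -> R) :
  continuous f -> measurable_fun [set: R * R] f.
Proof.
move=> /continuousP cf; apply: (measurability _ (RGenOpens.measurableE R)).
move=> _ [_ [a [b ->] <-]]; rewrite setTI; apply: open_measurable_plane.
exact/cf/interval_open.
Qed.

(** The image of Lebesgue measure under y / c, multiplied by 1 / c, has the right value on half-open
    intervals, hence is Lebesgue measure by uniqueness. *)
Lemma lebesgue_measure_dilation (c : R) (A : set R) : 0 < c -> measurable A ->
  lebesgue_measure ((fun y => y / c) @^-1` A) = (c%:E * lebesgue_measure A)%E.
Proof.
move=> c0 mA.
pose phi (y : measurableTypeR R) : measurableTypeR R := y / c.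
have mphi : measurable_fun setT phi by exact: mulrr_measurable.
pose k := NngNum (ltW (eqbRL (invr_gt0 c) c0)).
pose nu := measure_function_pushforward__canonical__measure_function_Measure
  lebesgue_measure mphi.
have -> : lebesgue_measure A = mscale k nu A.
  apply: lebesgue_measure_unique => // _ [[a b] _ <-].
  change (lebesgue_measure `]a, b] =
    (c^-1)%:E * lebesgue_measure (phi @^-1` `]a, b]))%E.
  have -> : phi @^-1` `]a, b] = `]c * a, c * b]%classic.
    apply/seteqP; split => y /=; rewrite !in_itv/= ltr_pdivlMr// ler_pdivrMr//;
      by rewrite ![c * _]mulrC.
  rewrite !lebesgue_measure_itv/= !lte_fin ltr_pM2l//.
  case: ifPn => _; last by rewrite mule0.
  by rewrite -!EFinD -EFinM -mulrBr mulKf// gt_eqF.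
change (lebesgue_measure (phi @^-1` A) =
  c%:E * ((c^-1)%:E * lebesgue_measure (phi @^-1` A)))%E.
by rewrite muleA -EFinM divff ?gt_eqF// mul1e.
Qed.

(** Change of variables y = x / eps: [leb2] is eps^-2 times its own image under [phi], and the
    factor eps^-2 in [Vsup] is exactly this Jacobian. *)
Lemma integral_Vsup (V : R * R -> R) (eps : R) : 0 < eps ->
  measurable_fun [set: R * R] V -> (forall x, 0 <= V x) ->
  (\int[@leb2 R]_x (Vsup V eps x)%:E = \int[@leb2 R]_x (V x)%:E)%E.
Proof.
move=> e0 mV V0.
have e20 : 0 < eps ^+ 2 by rewrite exprn_gt0.
(* leb2 lives on the product of [measurableTypeR R], not of [R] itself. *)
pose T2 := (measurableTypeR R * measurableTypeR R)%type.
pose phi (y : T2) : T2 := sdiv y eps.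
have mphi : measurable_fun setT phi.
  apply: measurable_fun_pair; apply: measurable_funM => //.
pose k := NngNum (ltW (eqbRL (invr_gt0 (eps ^+ 2)) e20)).
pose nu := measure_function_pushforward__canonical__measure_function_Measure
  (@leb2 R) mphi.
have scaleE (p q : \bar R) :
    ((eps ^- 2)%:E * ((eps%:E * p) * (eps%:E * q)) = p * q)%E.
  by rewrite muleACA -EFinM [LHS]muleA -EFinM -expr2 mulVf ?gt_eqF// mul1e.
have muE A : measurable A -> @leb2 R A = mscale k nu A.
  (* By uniqueness of the product measure it suffices to compare on rectangles, where each
     coordinate contributes one factor eps. *)
  move: A; refine (@product_measure_unique _ _ _ _ R
    lebesgue_measure lebesgue_measure (mscale k nu) _) => A B mA mB.
  change ((eps ^- 2)%:E * leb2 (phi @^-1` (A `*` B)) =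
    lebesgue_measure A * lebesgue_measure B)%E.
  have -> : phi @^-1` (A `*` B) =
    ((fun y => y / eps) @^-1` A) `*` ((fun y => y / eps) @^-1` B) by [].
  rewrite /leb2 product_measure1E//; last 2 first.
  - by rewrite -[X in measurable X]setTI; apply: mulrr_measurable.
  - by rewrite -[X in measurable X]setTI; apply: mulrr_measurable.
  change ((eps ^- 2)%:E * (lebesgue_measure ((fun y : R => (y / eps)%R) @^-1` A) *
    lebesgue_measure ((fun y : R => (y / eps)%R) @^-1` B)) =
    lebesgue_measure A * lebesgue_measure B)%E.
  by rewrite !lebesgue_measure_dilation//; exact: scaleE.
have mV' : measurable_fun [set: R * R] (V \o phi) by exact: measurableT_comp.
have mVE : measurable_fun setT (EFin \o V : T2 -> _).
  by apply/measurable_EFinP; exact: mV.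
rewrite [RHS](eq_measure_integral (mscale k nu)); last by move=> A mA _; exact: muE.
rewrite (ge0_integral_mscale _ measurableT)//; last by move=> x _; rewrite lee_fin.
rewrite (ge0_integral_pushforward mphi)//; last by move=> x _; rewrite lee_fin.
rewrite preimage_setT -ge0_integralZl//.
- by apply/measurable_EFinP; exact: mV'.
- by move=> x _; rewrite lee_fin.
Qed.

End plane_measurability.

(** * The logarithmic kernel averaged against a concentrated density *)

Section kernel_bound.
Context {R : realType}.
Implicit Types (x y z : R * R).

Lemma norm_le_enorm z : `|z| <= enorm z.
Proof.
rewrite prod_normE ge_max; apply/andP; split;
  by rewrite -sqrtr_sqr ler_sqrt ?addr_ge0 ?sqr_ge0// (lerDl, lerDr) sqr_ge0.
Qed.

Lemma enorm_le_norm z : enorm z <= 2 * `|z|.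
Proof.
have z0 : 0 <= `|z| by [].
have [z1 z2] : `|z.1| <= `|z| /\ `|z.2| <= `|z|.
  by rewrite prod_normE !le_max !lexx orbT.
rewrite -[leRHS]ger0_norm ?mulr_ge0// -sqrtr_sqr ler_sqrt ?sqr_ge0//.
rewrite -[z.1 ^+ 2]real_normK ?num_real// -[z.2 ^+ 2]real_normK ?num_real//.
have : `|z.1| ^+ 2 <= `|z| ^+ 2 by rewrite ler_sqr ?nnegrE.
have : `|z.2| ^+ 2 <= `|z| ^+ 2 by rewrite ler_sqr ?nnegrE.
have := sqr_ge0 `|z|; rewrite exprMn; lra.
Qed.

Lemma measurable_enormB x : measurable_fun [set: R * R] (fun y => enorm (x - y)).
Proof.
apply: (measurableT_comp (f := @Num.sqrt R)
  (g := fun y : R * R => (x.1 - y.1) ^+ 2 + (x.2 - y.2) ^+ 2)).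
  by apply: continuous_measurable_fun; exact: sqrt_continuous.
by apply: measurable_funD; apply: measurable_funX; apply: measurable_funB.
Qed.

(** A closed ball of the max norm, written as a product so that its measurability and area come from
    those of intervals. *)
Definition box x (r : R) : set (R * R) :=
  `[x.1 - r, x.1 + r]%classic `*` `[x.2 - r, x.2 + r]%classic.

Lemma boxE x r y : box x r y <-> `|x - y| <= r.
Proof.
rewrite prod_normE ge_max /box /= !in_itv/= !ler_distlC.
by split=> [[-> ->]//|/andP[-> ->]].
Qed.

Lemma measurable_box x r : measurable (box x r).
Proof. by apply: measurableX; exact: measurable_itv. Qed.

Lemma leb2_box x r : 0 <= r -> leb2 (box x r) = ((2 * r) ^+ 2)%:E.
Proof.
move=> r0; rewrite /leb2 product_measure1E//.
have itvE c : lebesgue_measure `[c - r, c + r] = (2 * r)%:E.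
  rewrite lebesgue_measure_itv/= lte_fin; case: ifPn => [_|].
    by rewrite -EFinB; congr EFin; ring.
  by rewrite -leNgt => ?; congr EFin; lra.
change (lebesgue_measure `[(x.1 - r)%R, (x.1 + r)%R]%classic *
  lebesgue_measure `[(x.2 - r)%R, (x.2 + r)%R]%classic = ((2 * r) ^+ 2)%:E)%E.
by rewrite !itvE -EFinM expr2.
Qed.

(** With n the integer part of - ln s, s <= e^-n <= 2^-n because e >= 2. *)
Lemma neg_ln_le_dyadic (s : R) : 0 < s -> s <= 1 ->
  exists n : nat, s <= (2 ^+ n)^-1 /\ - ln s <= n.+1%:R.
Proof.
move=> s0 s1; exists (Num.trunc (- ln s)).
have v0 : 0 <= - ln s by rewrite oppr_ge0 -ln1 ler_ln ?posrE.
have /andP[nv vn] := truncn_itv v0; split; last exact: ltW.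
set n := Num.trunc _ in nv *.
have two_e : (2 : R) <= expR 1 by have := expR_ge1Dx (1 : R); lra.
rewrite -[s]invrK lef_pV2 ?posrE ?invr_gt0 ?exprn_gt0//.
have -> : s^-1 = expR (- ln s) by rewrite expRN lnK ?posrE.
apply: (@le_trans _ _ (expR n%:R)); last by rewrite ler_expR.
by rewrite -[n%:R]mul1r expRM_natr lerXn2r ?nnegrE ?expR_ge0.
Qed.

(* |ln t| <= 4 r + sum_n [t <= 2^-n] replaces the logarithmic singularity by a
   series of indicators of squares, so that no improper integral is needed.
   At z = 0, where ln 0 = 0, every indicator is on and any large n will do. *)
Lemma log_kernel_dyadic (eps r : R) z : 0 < eps -> eps < 1 ->
  `|z| <= 2 * (eps * r) ->
  `|ln (enorm z) + `|ln eps| | <= 4 * r \/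
  exists n : nat, `|z| <= eps / 2 ^+ n /\ `|ln (enorm z) + `|ln eps| | <= n.+1%:R.
Proof.
move=> e0 e1 zr; have [z0|z0] := eqVneq z 0.
  right; exists (Num.trunc `|ln eps|); split.
    by rewrite z0 normr0 divr_ge0// ?exprn_ge0// ltW.
  rewrite z0 /enorm/= expr0n/= addr0 sqrtr0 ln0// add0r normr_id.
  by have /andP[_ /ltW] := truncn_itv (normr_ge0 (ln eps)).
have nz0 : 0 < `|z| by rewrite normr_gt0.
have ez0 : 0 < enorm z by exact: lt_le_trans (norm_le_enorm z).
have -> : ln (enorm z) + `|ln eps| = ln (enorm z / eps).
  by rewrite ln_div ?posrE// ler0_norm// -ln1 ler_ln ?posrE// ltW.
have t0 : 0 < enorm z / eps by rewrite divr_gt0.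
have [t1|t1] := leP 1 (enorm z / eps).
  left; rewrite ger0_norm ?ln_ge0//.
  (* For t >= 1, 0 <= ln t < t. The constant 4 r collects the factor 2 between the two norms and the
     factor 2 in |z| <= 2 eps r. *)
  apply: (le_trans (ltW (ln_sublinear t0))).
  by rewrite ler_pdivrMr//; have := enorm_le_norm z; lra.
right; have s0 : 0 < `|z| / eps by rewrite divr_gt0.
have st : `|z| / eps <= enorm z / eps.
  by rewrite ler_pM2r ?invr_gt0//; exact: norm_le_enorm.
(* The index n is chosen from the max norm, so that the indicators are those of squares; passing to
   the larger Euclidean norm only decreases - ln. *)
have [n [sn lsn]] := neg_ln_le_dyadic _ s0 (le_trans st (ltW t1)).
exists n; split; first by rewrite -ler_pdivrMl// mulrC.
have lt : ln (enorm z / eps) <= 0 by rewrite -ln1 ler_ln ?posrE// ltW.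
by rewrite ler0_norm// (le_trans _ lsn)// lerN2 ler_ln ?posrE.
Qed.

(** The indices 0, ..., n make n + 1 terms, which matches the bound [n.+1] of
    [log_kernel_dyadic]. *)
Lemma nneseries_ge_prefix (c : R) (n : nat) (f : nat -> R) : (forall i, 0 <= f i) ->
  (forall i, (i <= n)%N -> f i = c) ->
  ((n.+1%:R * c)%:E <= \sum_(i <oo) (f i)%:E)%E.
Proof.
move=> f0 fc; apply: le_trans (nneseries_lim_ge n.+1 _); last first.
  by move=> i _ _; rewrite lee_fin.
rewrite sumEFin lee_fin big_mkord (eq_bigr (fun=> c)); last first.
  by move=> i _; rewrite fc// -ltnS.
by rewrite sumr_const card_ord mulr_natl.
Qed.

(** The part 4 r is integrated against the unit mass of [W]. The n-th square has area 4 eps^2 / 4^n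
    and [W] is at most B / eps^2 there, so it contributes at most 4 B / 4^n; these sum to at most 8
    B. The powers of eps cancel, which makes the bound uniform. *)
Lemma log_kernel_bound (W : R * R -> R) (eps r B : R) x :
  0 < eps -> eps < 1 -> 0 <= r -> 0 <= B ->
  measurable_fun setT W -> (forall y, 0 <= W y) ->
  (forall y, W y <= B / eps ^+ 2) ->
  (forall y, ~ `|y| <= eps * r -> W y = 0) ->
  (\int[@leb2 R]_y (W y)%:E = 1)%E ->
  `|x| <= eps * r ->
  (\int[@leb2 R]_y (`|ln (enorm (x - y)) + `|ln eps| | * W y)%:E <=
    (4 * r + 8 * B)%:E)%E.
Proof.
move=> e0 e1 r0 B0 mW W0 WB suppW intW xr.
have e2n n : 0 <= eps / 2 ^+ n by rewrite divr_ge0 ?exprn_ge0// ltW.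
pose b n := box x (eps / 2 ^+ n).
have mb n : measurable (b n) by exact: measurable_box.
pose f n y : R := \1_(b n) y * W y.
have f0 n y : 0 <= f n y by rewrite mulr_ge0// indicE.
have mI n : measurable_fun [set: R * R] (fun y => (\1_(b n) y)%:E : \bar R).
  by apply/measurable_EFinP; exact: measurable_indic.
have mBI n : measurable_fun [set: R * R] (fun y =>
    ((B / eps ^+ 2)%:E * (\1_(b n) y)%:E)%E).
  exact: measurable_funeM.
have mf n : measurable_fun setT (EFin \o f n).
  by apply/measurable_EFinP; apply: measurable_funM => //; exact: measurable_indic.
have mrW : measurable_fun setT (fun y => (4 * r * W y)%:E).
  by apply/measurable_EFinP; exact: measurable_funM.
have rW0 y : (0 <= (4 * r * W y)%:E)%E by rewrite lee_fin !mulr_ge0.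
have series0 y : (0 <= \sum_(n <oo) (f n y)%:E)%E.
  by apply: nneseries_ge0 => n _ _; rewrite lee_fin.
have mseries : measurable_fun setT (fun y => \sum_(n <oo) (f n y)%:E)%E.
  apply: (@ge0_emeasurable_sum _ _ _ _ (fun n y => (f n y)%:E) xpredT).
    by move=> n y _ _; rewrite lee_fin.
  by move=> n _; exact: mf.
have pointwise y : ((`|ln (enorm (x - y)) + `|ln eps| | * W y)%:E <=
    (4 * r * W y)%:E + \sum_(n <oo) (f n y)%:E)%E.
  have [yr|/suppW Wy0] := pselect (`|y| <= eps * r); last first.
    by rewrite Wy0 !mulr0 add0e.
  have xyr : `|x - y| <= 2 * (eps * r).
    by rewrite (le_trans (ler_normB _ _))//; lra.
  case: (log_kernel_dyadic _ _ _ e0 e1 xyr) => [le4r|[n [xyn len]]].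
    by rewrite (@le_trans _ _ (4 * r * W y)%:E)// ?leeDl// lee_fin ler_wpM2r.
  apply: (@le_trans _ _ (n.+1%:R * W y)%:E); first by rewrite lee_fin ler_wpM2r.
  apply: (@le_trans _ _ (\sum_(n <oo) (f n y)%:E)%E); last by rewrite leeDr.
  (* The squares are nested: a point of the n-th one lies in all earlier ones, so the first n + 1
     terms all equal [W y]. *)
  apply: nneseries_ge_prefix => // i ni; rewrite /f indicE mem_set ?mul1r//.
  apply/boxE; apply: (le_trans xyn); rewrite ler_pM2l// lef_pV2 ?posrE ?exprn_gt0//.
  by rewrite ler_eXn2l// ltr1n.
apply: (@le_trans _ _ (\int[@leb2 R]_y ((4 * r * W y)%:E + \sum_(n <oo) (f n y)%:E))%E).
  apply: ge0_le_integral => //.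
  - by move=> y _; rewrite lee_fin mulr_ge0.
  - apply/measurable_EFinP; apply: measurable_funM => //; apply: measurableT_comp => //.
    apply: measurable_funD => //; apply: measurableT_comp; first exact: measurable_ln.
    exact: measurable_enormB.
  - exact: emeasurable_funD.
rewrite ge0_integralD//.
under eq_integral do rewrite EFinM.
rewrite ge0_integralZl//; last 3 first.
- exact/measurable_EFinP.
- by move=> y _; rewrite lee_fin.
- by rewrite lee_fin mulr_ge0.
rewrite intW mule1 EFinD leeD2l// integral_nneseries//; last first.
  by move=> n y _; rewrite lee_fin.
(* The terms are compared with 8 B / 2^(n + 1) = 4 B / 2^n, whose sum is at most 8 B. *)
apply: le_trans (epsilon_trick0 xpredT _); last by rewrite mulr_ge0.
apply: lee_nneseries => [n _ _|n _]; first by apply: integral_ge0 => y _; rewrite lee_fin.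
apply: (@le_trans _ _ (\int[@leb2 R]_y ((B / eps ^+ 2)%:E * (\1_(b n) y)%:E))%E).
  apply: ge0_le_integral => //.
  - by move=> y _; rewrite lee_fin.
  - exact: mf.
  - exact: mBI.
  - by move=> y _; rewrite -EFinM lee_fin [leRHS]mulrC ler_wpM2l// indicE.
rewrite ge0_integralZl//; last 2 first.
- exact: mI.
- by rewrite lee_fin divr_ge0 ?sqr_ge0.
have -> : (\int[@leb2 R]_y (\1_(b n) y)%:E = ((2 * (eps / 2 ^+ n)) ^+ 2)%:E)%E.
  transitivity (leb2 (b n `&` setT)); last by rewrite setIT leb2_box.
  by apply: integral_indic => //; exact: mb.
rewrite -EFinM lee_fin.
have -> : B / eps ^+ 2 * (2 * (eps / 2 ^+ n)) ^+ 2 = 4 * B / 2 ^+ n / 2 ^+ n.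
  by field; rewrite gt_eqF//= gt_eqF// exprn_gt0.
rewrite natrX exprS invfM.
have -> : 8 * B * (2^-1 / 2 ^+ n) = 4 * B / 2 ^+ n by field; rewrite gt_eqF// exprn_gt0.
rewrite ler_piMr ?mulr_ge0 ?invr_ge0 ?exprn_ge0//.
by rewrite invf_le1 ?exprn_gt0// exprn_ege1// ler1n.
Qed.

End kernel_bound.

(** * Continuity and boundedness of the data *)

Section continuity.
Context {R : realType}.

Lemma holder_continuous_continuous (V : R * R -> R) :
  holder_continuous V -> continuous V.
Proof.
move=> [al [C [al0 [_ holderV]]]] x; apply/cvgrPdist_le => e e0.
(* The Hölder constant [C] may be zero or negative; [D] is a positive majorant, and [rho] below
   solves D rho^al = e. *)
pose D := `|C| + 1; have D0 : 0 < D by rewrite ltr_pwDr.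
pose rho := (e / D) `^ al^-1.
have rho0 : 0 < rho by rewrite powR_gt0// divr_gt0.
near=> y; apply: (le_trans (holderV x y)).
apply: (@le_trans _ _ (D * rho `^ al)).
  apply: (@le_trans _ _ (D * enorm (x - y) `^ al)).
    by rewrite ler_wpM2r ?powR_ge0// (le_trans (ler_norm C))// lerDl.
  rewrite ler_wpM2l ?(ltW D0)// ge0_ler_powR ?nnegrE ?(ltW al0) ?(ltW rho0) ?sqrtr_ge0//.
  apply: (le_trans (enorm_le_norm _)); rewrite mulrC -ler_pdivlMr//.
  near: y; apply: cvgr_dist_le; first exact: cvg_id.
  by rewrite divr_gt0.
rewrite -powRrM mulVf ?gt_eqF// powRr1 ?divr_ge0 ?(ltW e0) ?(ltW D0)//.
by rewrite mulrC divfK ?gt_eqF.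
Unshelve. all: by end_near. Qed.

Lemma continuous_bounded_plane (f : R * R -> R) (r : R) : continuous f ->
  exists M, forall y, `|y| <= r -> `|f y| <= M.
Proof.
move=> cf.
have cbox : compact (`[- r, r]%classic `*` `[- r, r]%classic : set (R * R)).
  by apply: compact_setX; exact: segment_compact.
have := continuous_compact (continuous_subspaceT cf) cbox.
move=> /compact_bounded /pinfty_ex_gt0[M _ fM]; exists M => y yr.
apply: fM; exists y => //.
move: yr; rewrite prod_normE ge_max => /andP[].
by rewrite !ler_norml => y1 y2; split; rewrite /= in_itv.
Qed.

Lemma compact_support_bounded (V : R * R -> R) : compact_support V ->
  exists r, forall y, V y != 0 -> `|y| <= r.
Proof.
move=> /compact_bounded /pinfty_ex_gt0[r _ Vr]; exists r => y Vy.
by apply: Vr; exact: subset_closure.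
Qed.

End continuity.

(** * The limit theorem: choice of constants and reduction to the fixed-point estimate *)

Theorem theorem3p2 (R : realType) (V : R * R -> R) (tau : R)
  (u : R -> R * R -> R) :
  (forall x, 0 <= V x) ->
  holder_continuous V ->
  compact_support V ->
  (\int[@leb2 R]_x (V x)%:E = 1)%E ->
  0 < tau ->
  (exists eps0 : R, 0 < eps0 /\ forall eps, 0 < eps -> eps < eps0 -> eps < 1 ->
     C2 (u eps) /\ log_growth (u eps) /\ solves_eq tau V eps (u eps)) ->
  forall k : R, 0 < k ->
    forall eta : R, 0 < eta -> exists delta : R, 0 < delta /\
      forall eps, 0 < eps -> eps < delta -> eps < 1 ->
        forall x : R * R, enorm x <= k ->
          `|u eps (smul eps x) * `|ln eps|^-1 + tau / (2 * pi + tau)| <= eta.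
Proof.
move=> V0 holderV suppV intV tau0 [eps0 [eps00 solu]] k k0 eta eta0.
have cV := holder_continuous_continuous _ holderV.
have [r1 Vr1] := compact_support_bounded _ suppV.
(* One radius serves both purposes: the square |y| <= eps r contains the support of [Vsup V eps] and
   every point eps x with [enorm x <= k]. *)
pose r := Num.max r1 k.
have r0 : 0 < r by rewrite lt_max k0 orbT.
have Vr y : V y != 0 -> `|y| <= r by move=> /Vr1 yr; rewrite le_max yr.
have [B [B0 VB]] : exists B, 0 <= B /\ forall y, V y <= B.
  have [M VM] := continuous_bounded_plane _ r cV.
  exists `|M|; split => // y; have [->//|/Vr/VM VyM] := eqVneq (V y) 0.
  by rewrite (le_trans (ler_norm _))// (le_trans VyM)// ler_norm.
pose a := tau / (2 * pi).
have pi2 : 0 < 2 * pi :> R by rewrite mulr_gt0// pi_gt0.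
have a0 : 0 < a by rewrite divr_gt0.
pose C := 4 * r + 8 * B.
have C0 : 0 <= C by rewrite /C; lra.
have aC0 : 0 <= 4 * (a * C) by have := mulr_ge0 (ltW a0) C0; lra.
(* The first summand secures the condition 4 a C <= L of [fixed_point_stability], the second makes
   its error 4 a C / L at most [eta]. The bound eps < exp(- Lam) below is Lam < |ln eps|. *)
pose Lam := 4 * (a * C) + 4 * (a * C) / eta.
exists (Num.min eps0 (expR (- Lam))); split.
  by rewrite lt_min eps00 expR_gt0.
move=> eps e0; rewrite lt_min => /andP[eeps0 eLam] e1 x xk.
have [[cu _] [_ solves]] := solu eps e0 eeps0 e1.
pose L := `|ln eps|.
have LLam : Lam < L.
  rewrite /L ltr0_norm; last by rewrite -ln1 ltr_ln ?posrE.
  by rewrite ltrNr -(expRK (- Lam)) ltr_ln ?posrE// expR_gt0.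
have [L1 L2] : 4 * (a * C) <= L /\ 4 * (a * C) / eta <= L.
  have : 0 <= 4 * (a * C) / eta by rewrite divr_ge0 ?(ltW eta0).
  by move: LLam; rewrite /Lam; split; lra.
have L0 : 0 < L.
  by apply: le_lt_trans LLam; rewrite addr_ge0// divr_ge0// ltW.
pose h y := u eps y / L + 1.
pose A := [set y : R * R | `|y| <= eps * r].
pose W := Vsup V eps.
have mV := continuous_measurable_plane _ cV.
have mW : measurable_fun [set: R * R] W.
  apply: measurable_funM => //; apply: measurableT_comp => //.
  by apply: measurable_fun_pair; apply: measurable_funM.
have W0 y : 0 <= W y by rewrite mulr_ge0// invr_ge0 exprn_ge0// ltW.
have supp_W y : ~ A y -> W y = 0.
  move=> nAy; rewrite /W /Vsup.
  have [->|/Vr] := eqVneq (V (sdiv y eps)) 0; first by rewrite mulr0.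
  rewrite prod_normE ge_max/= !normrM [`|eps^-1|]gtr0_norm ?invr_gt0//.
  rewrite !ler_pdivrMr// ![r * _]mulrC => yr.
  by exfalso; apply: nAy; rewrite /A/= prod_normE ge_max.
have int_W : (\int[@leb2 R]_y (W y)%:E = 1)%E by rewrite integral_Vsup.
have ch : continuous h.
  by move=> y; apply: cvgD; [apply: cvgMl; exact: cu|exact: cvg_cst].
(* [M] depends on [eps], harmlessly, since the conclusion of [fixed_point_stability] does not
   involve it. *)
have [M hM] := continuous_bounded_plane _ (eps * r) ch.
have kernE y : kern tau V eps (u eps) y =
    fun z => ln (enorm (y - z)) * (W z * h z).
  by apply/funext => z; rewrite /kern /W /h /Vsub /Vsup -/L; ring.
have mG y : measurable_fun [set: R * R] (fun z => ln (enorm (y - z))).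
  by apply: measurableT_comp; [exact: measurable_ln|exact: measurable_enormB].
have h_fix y : A y -> h y = 1 + a / L *
    Rintegral (@leb2 R) setT (fun z => ln (enorm (y - z)) * (W z * h z)).
  move=> _; rewrite {1}/h; have [_ ->] := solves y.
  by rewrite kernE /a; ring.
have int_GWh y : A y -> (@leb2 R).-integrable setT
    (EFin \o (fun z => ln (enorm (y - z)) * (W z * h z))).
  by move=> _; have [] := solves y; rewrite kernE.
have WB y : W y <= B / eps ^+ 2.
  by rewrite /W /Vsup mulrC ler_wpM2r// invr_ge0 exprn_ge0// ltW.
have kernel_le y : A y ->
    (\int[@leb2 R]_z (`|ln (enorm (y - z)) + L| * W z)%:E <= C%:E)%E.
  exact: (log_kernel_bound W eps r B y e0 e1 (ltW r0) B0 mW W0 WB supp_W int_W).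
have Ax : A (smul eps x).
  rewrite /A/= prod_normE ge_max/= !normrM !(gtr0_norm e0) !ler_pM2l//.
  rewrite -ge_max -prod_normE (le_trans (norm_le_enorm _))//.
  by rewrite (le_trans xk)// le_max lexx orbT.
have := fixed_point_stability _ _ _ (@leb2 R) _ _ _ _ _ _ _ a0 C0 L0 W0 mW supp_W int_W
  (continuous_measurable_plane _ ch) mG int_GWh kernel_le h_fix M L1 hM _ Ax.
(* The limit constant appears as 1 - 1 / (1 + a) = a / (1 + a) = tau / (2 pi + tau). *)
have -> : h (smul eps x) - (1 + a)^-1 =
    u eps (smul eps x) * `|ln eps|^-1 + tau / (2 * pi + tau).
  (* [field] would unfold [pi], hence the generalization *)
  rewrite /h -/L /a; move: (@pi R) (pi_gt0 R) => p p0; field.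
  by rewrite !gt_eqF ?addr_gt0 ?mulr_gt0.
move=> /le_trans; apply; rewrite ler_pdivrMr//.
by rewrite -ler_pdivrMl// mulrC.
Qed.
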